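(* Let $g=\sum_{u=1}^4g_u\rho(u)+g_{\mathfrak X}\chi(\mathfrak X)\in C(\mathbb{KP})$, with complex coefficients, be such that $\mathcal F(g)$ is a state on $C(\mathbb{KP})$. For all $u\in\{2,3,4\}$ and all positive integers $k$, $$\frac12|g_u|^k\le\left\lVert\mathcal F(g)^{\star k}-\int_{\mathbb{KP}}\right\rVert_{QTV}\le\sqrt{\frac14\sum_{v=2}^4|g_v|^{2k}+\frac{|g_{\mathfrak X}|^{2k}}{4^k}}.$$
   Context: Kac–Paljutkin quantum group $\mathbb{KP}$: $C(\mathbb{KP})=\mathbb C\oplus\mathbb C\oplus\mathbb C\oplus\mathbb C\oplus M_2(\mathbb C)$ as a $*$-algebra, with canonical basis $e_1,e_2,e_3,e_4,E_{11},E_{12},E_{21},E_{22}$. Its Haar state is $\int_{\mathbb{KP}}(x_1\oplus x_2\oplus x_3\oplus x_4\oplus(c_{ij}))=\frac18(x_1+x_2+x_3+x_4+2(c_{11}+c_{22}))$. Its irreducible representations are the one-dimensional $\rho(1)=e_1+e_2+e_3+e_4+E_{11}+E_{22}$ (the unit), $\rho(2)=e_1-e_2-e_3+e_4+E_{11}-E_{22}$, $\rho(3)=e_1-e_2-e_3+e_4-E_{11}+E_{22}$, $\rho(4)=e_1+e_2+e_3+e_4-E_{11}-E_{22}$, and the two-dimensional $\mathfrak X=(\mathfrak X_{ij})_{1\le i,j\le 2}$ with $\mathfrak X_{11}=e_1-e_2+e_3-e_4$, $\mathfrak X_{12}=e^{\imath\pi/4}E_{12}+e^{-\imath\pi/4}E_{21}$,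 $\mathfrak X_{21}=e^{-\imath\pi/4}E_{12}+e^{\imath\pi/4}E_{21}$, $\mathfrak X_{22}=e_1+e_2-e_3-e_4$, whose character is $\chi(\mathfrak X)=2e_1-2e_4$. These eight coefficients form a linear basis of $C(\mathbb{KP})$, and the coproduct $\Delta$ is the linear map determined by $\Delta(\rho(u))=\rho(u)\otimes\rho(u)$ and $\Delta(\mathfrak X_{ij})=\sum_k\mathfrak X_{ik}\otimes\mathfrak X_{kj}$. For $x\in C(\mathbb{KP})$, $\mathcal F(x)$ is the linear functional $y\mapsto\int_{\mathbb{KP}}yx$; convolution of functionals is $\phi\star\psi=(\phi\otimes\psi)\circ\Delta$. A state is a positive unital linear functional. $\lVert\phi-\psi\rVert_{QTV}=\sup\{|\phi(p)-\psi(p)|:p\in C(\mathbb{KP})\text{ a projection}\}$. *)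

(* Defs.v *)
From HB Require Import structures.
From mathcomp Require Import all_boot all_order all_algebra.
From mathcomp Require Import complex.
From mathcomp Require Import all_classical all_reals all_analysis.
From mathcomp Require Import ring lra.

Set Implicit Arguments.
Unset Strict Implicit.
Unset Printing Implicit Defensive.

Import Order.TTheory GRing.Theory Num.Theory.
Local Open Scope complex_scope.
Local Open Scope ring_scope.
Local Open Scope classical_set_scope.

(* C^o is C seen as a module over itself, so that the product below carries
   both its vector space and its (componentwise) ring structure. *)
Definition KP (R : realType) : Type :=
  (R[i]^o * R[i]^o * R[i]^o * R[i]^o * 'M[R[i]]_2)%type.

Section KacPaljutkin.
Variable R : realType.
Local Notation C := R[i].
Local Notation KP := (KP R).

Definition mkKP (x1 x2 x3 x4 : C) (c : 'M[C]_2) : KP := (x1, x2, x3, x4, c).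

Definition star (x : KP) : KP :=
  let: (x1, x2, x3, x4, c) := x in
  mkKP x1^*%C x2^*%C x3^*%C x4^*%C (map_mx conjc c^T).

Definition is_projection (p : KP) : Prop := star p = p /\ p * p = p.

(* On R[i], 0 <= z says that z is real and nonnegative. *)
Definition is_state (phi : KP -> C) : Prop :=
  [/\ scalar phi, forall x, 0 <= phi (star x * x) & phi 1 = 1].

Definition haar (x : KP) : C :=
  let: (x1, x2, x3, x4, c) := x in
  8^-1 * (x1 + x2 + x3 + x4 + 2 * \tr c).

Definition fourier (x : KP) : KP -> C := fun y => haar (y * x).

Definition e1 : KP := mkKP 1 0 0 0 0.
Definition e2 : KP := mkKP 0 1 0 0 0.
Definition e3 : KP := mkKP 0 0 1 0 0.
Definition e4 : KP := mkKP 0 0 0 1 0.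
Definition E (i j : 'I_2) : KP := mkKP 0 0 0 0 (delta_mx i j).

Definition expi (t : R) : C := cos t +i* sin t.

(* 'I_4 counts from 0: rho u is the representation usually numbered u + 1,
   and rho 0 is the unit. Likewise for the indices of X. *)
Definition rho (u : 'I_4) : KP :=
  tnth [tuple e1 + e2 + e3 + e4 + E 0 0 + E 1 1;
              e1 - e2 - e3 + e4 + E 0 0 - E 1 1;
              e1 - e2 - e3 + e4 - E 0 0 + E 1 1;
              e1 + e2 + e3 + e4 - E 0 0 - E 1 1] u.

Definition X (i j : 'I_2) : KP :=
  if i == 0 then
    if j == 0 then e1 - e2 + e3 - e4
    else expi (pi / 4) *: E 0 1 + expi (- (pi / 4)) *: E 1 0
  else
    if j == 0 then expi (- (pi / 4)) *: E 0 1 + expi (pi / 4) *: E 1 0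
    else e1 + e2 - e3 - e4.

Definition chiX : KP := \sum_i X i i.

Definition can_basis : 8.-tuple KP :=
  [tuple e1; e2; e3; e4; E 0 0; E 0 1; E 1 0; E 1 1].

Definition coef_basis : 8.-tuple KP :=
  [tuple rho 0; rho 1; rho 2; rho 3; X 0 0; X 0 1; X 1 0; X 1 1].

(* C(KP) (x) C(KP) is modelled by 8 x 8 matrices: T i j is the coordinate of T
   on can_basis`_i (x) can_basis`_j. *)
Definition tens (x y : KP) : 'M[C]_8 :=
  \matrix_(i, j) (coord can_basis i x * coord can_basis j y).

(* phi (x) psi, for linear phi and psi *)
Definition tens_fun (phi psi : KP -> C) (T : 'M[C]_8) : C :=
  \sum_i \sum_j T i j * (phi can_basis`_i * psi can_basis`_j).

Definition Delta_rho (u : 'I_4) : 'M[C]_8 := tens (rho u) (rho u).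
Definition Delta_X (i j : 'I_2) : 'M[C]_8 := \sum_k tens (X i k) (X k j).

Definition Delta (x : KP) : 'M[C]_8 :=
  \sum_(i < 8) coord coef_basis i x *:
    tnth [tuple Delta_rho 0; Delta_rho 1; Delta_rho 2; Delta_rho 3;
                Delta_X 0 0; Delta_X 0 1; Delta_X 1 0; Delta_X 1 1] i.

Definition conv (phi psi : KP -> C) : KP -> C :=
  fun x => tens_fun phi psi (Delta x).

(* The counit is evaluation at the e1-component; it only serves as the power
   of exponent 0, and conv_pow phi 1 is phi. *)
Definition counit (x : KP) : C := x.1.1.1.1.
Definition conv_pow (phi : KP -> C) (k : nat) : KP -> C :=
  iterop k conv phi counit.

(* The set is nonempty and, for linear phi and psi, bounded, so that sup is its
   least upper bound. *)
Definition QTV (phi psi : KP -> C) : R :=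
  sup [set Normc.normc (phi p - psi p) | p in is_projection].

Lemma mulKPE (x1 x2 x3 x4 y1 y2 y3 y4 : C) (c d : 'M[C]_2) :
  mkKP x1 x2 x3 x4 c * mkKP y1 y2 y3 y4 d =
  mkKP (x1 * y1) (x2 * y2) (x3 * y3) (x4 * y4) (c *m d).
Proof. by []. Qed.

Lemma rho0E : rho 0 = 1.
Proof.
rewrite /rho (tnth_nth 0) /= /e1 /e2 /e3 /e4 /E /mkKP.
congr (_, _, _, _, _) => /=; rewrite ?(addr0, add0r) //.
apply/matrixP=> i j; rewrite !mxE.
by case: i => [[|[|//]] ?]; case: j => [[|[|//]] ?]; rewrite /= ?(addr0, add0r).
Qed.

Lemma chiXE : chiX = 2 *: e1 - 2 *: e4.
Proof.
rewrite /chiX big_ord_recl big_ord1 /X /= /e1 /e2 /e3 /e4 /mkKP.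
congr (_, _, _, _, _) => /=; rewrite ?(scaler0, addr0, add0r, subr0, oppr0) //.
- by rewrite /GRing.scale /= mulr1.
- by rewrite addNr.
- by rewrite subrr.
- by rewrite /GRing.scale /= mulr1 -opprD.
Qed.

Let KPP (x y : KP) : x = y ->
  [/\ x.1.1.1.1 = y.1.1.1.1, x.1.1.1.2 = y.1.1.1.2, x.1.1.2 = y.1.1.2,
      x.1.2 = y.1.2 & x.2 = y.2].
Proof. by move=> ->. Qed.

Lemma can_basis_free : free can_basis.
Proof.
suff H (k0 k1 k2 k3 k4 k5 k6 k7 : C) :
    k0 *: e1 + (k1 *: e2 + (k2 *: e3 + (k3 *: e4 + (k4 *: E 0 0 +
      (k5 *: E 0 1 + (k6 *: E 1 0 + k7 *: E 1 1)))))) = 0 ->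
    forall i : 'I_8, [:: k0; k1; k2; k3; k4; k5; k6; k7]`_i = 0.
  apply/freeP=> k; rewrite !big_ord_recl big_ord0 addr0 /= => /H {H}.
  move=> H i; rewrite -[RHS](H i); case: i => [[|[|[|[|[|[|[|[|//]]]]]]]] i_lt8];
    congr k; exact: val_inj.
rewrite /e1 /e2 /e3 /e4 /E /mkKP => /KPP[] /=.
rewrite /GRing.scale /= !(mulr0, addr0, add0r, mulr1) => -> -> -> -> /matrixP h.
have := (h 0 0, h 0 1, h 1 0, h 1 1) => {h}.
rewrite !mxE /= !(mulr0, addr0, add0r, mulr1) => -[[[-> ->] ->] ->].
by case=> [[|[|[|[|[|[|[|[|//]]]]]]]] i_lt8].
Qed.

Let dim_KP : \dim {:KP} = 8.
Proof. by rewrite dimvf. Qed.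

Lemma can_basisP : basis_of fullv can_basis.
Proof. by rewrite basisEfree can_basis_free subvf size_tuple dim_KP. Qed.

Lemma expi_pi4 : expi (pi / 4) ^+ 2 = 'i.
Proof.
rewrite expr2 /expi; apply/eqP; rewrite eq_complex /=.
rewrite -cosD [X in _ && (X == _)]addrC -sinD (_ : pi / 4 + pi / 4 = pi / 2); last by field.
by rewrite cos_pihalf sin_pihalf !eqxx.
Qed.

Lemma expi_Npi4 : expi (- (pi / 4)) ^+ 2 = - 'i.
Proof.
rewrite expr2 /expi; apply/eqP; rewrite eq_complex /=.
rewrite -cosD [X in _ && (X == _)]addrC -sinD (_ : - (pi / 4) + - (pi / 4) = - (pi / 2)); last by field.
by rewrite cosN sinN cos_pihalf sin_pihalf oppr0 !eqxx.
Qed.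

Lemma coef_basis_free : free coef_basis.
Proof.
suff H (k0 k1 k2 k3 k4 k5 k6 k7 : C) :
    k0 *: rho 0 + (k1 *: rho 1 + (k2 *: rho 2 + (k3 *: rho 3 + (k4 *: X 0 0 +
      (k5 *: X 0 1 + (k6 *: X 1 0 + k7 *: X 1 1)))))) = 0 ->
    forall i : 'I_8, [:: k0; k1; k2; k3; k4; k5; k6; k7]`_i = 0.
  apply/freeP=> k; rewrite !big_ord_recl big_ord0 addr0 /= => /H {H}.
  move=> H i; rewrite -[RHS](H i); case: i => [[|[|[|[|[|[|[|[|//]]]]]]]] i_lt8];
    congr k; exact: val_inj.
rewrite /rho !(tnth_nth 0) /= /X /=.
rewrite /e1 /e2 /e3 /e4 /E /mkKP => /KPP[] /=.
rewrite /GRing.scale /= !(oppr0, mulr0, addr0, add0r, mulr1, mulrN).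
set a := expi (pi / 4). set b := expi (- (pi / 4)).
move=> h1 h2 h3 h4 /matrixP h.
have := (h 0 0, h 0 1, h 1 0, h 1 1) => {h}.
rewrite !mxE /= !(oppr0, mulr0, addr0, add0r, mulr1, mulrN).
move=> -[[[h5 h6] h7] h8].
have lin m (x : C) : (0 < m)%N -> m%:R * x = 0 -> x = 0.
  by case: m => // m _ /eqP; rewrite mulf_eq0 pnatr_eq0 => /eqP.
have k0E : k0 = 0.
  apply: (@lin 8) => //; transitivity (0 + 0 + 0 + 0 + 2 * 0 + 2 * 0 : C).
    by rewrite -{1}h1 -{1}h2 -{1}h3 -{1}h4 -{1}h5 -h8; ring.
  by rewrite !(mulr0, addr0).
have k1E : k1 = 0.
  apply: (@lin 8) => //; transitivity (0 - 0 - 0 + 0 + 2 * 0 - 2 * 0 : C).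
    by rewrite -{1}h1 -{1}h2 -{1}h3 -{1}h4 -{1}h5 -h8; ring.
  by rewrite !(mulr0, addr0, subr0).
have k2E : k2 = 0.
  apply: (@lin 8) => //; transitivity (0 - 0 - 0 + 0 - 2 * 0 + 2 * 0 : C).
    by rewrite -{1}h1 -{1}h2 -{1}h3 -{1}h4 -{1}h5 -h8; ring.
  by rewrite !(mulr0, addr0, subr0).
have k3E : k3 = 0.
  apply: (@lin 8) => //; transitivity (0 + 0 + 0 + 0 - 2 * 0 - 2 * 0 : C).
    by rewrite -{1}h1 -{1}h2 -{1}h3 -{1}h4 -{1}h5 -h8; ring.
  by rewrite !(mulr0, addr0, subr0).
have k4E : k4 = 0.
  apply: (@lin 4) => //; transitivity (0 - 0 + 0 - 0 : C).
    by rewrite -{1}h1 -{1}h2 -{1}h3 -h4; ring.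
  by rewrite !(addr0, subr0).
have k7E : k7 = 0.
  apply: (@lin 4) => //; transitivity (0 + 0 - 0 - 0 : C).
    by rewrite -{1}h1 -{1}h2 -{1}h3 -h4; ring.
  by rewrite !(addr0, subr0).
have i_neq0 : ('i : C) != 0 by rewrite eq_complex /= eqxx oner_eq0.
have ab : a ^+ 2 - b ^+ 2 = 2 * 'i.
  by rewrite expi_pi4 expi_Npi4; ring.
have k5E : k5 = 0.
  apply: (@lin 2) => //; apply: (mulIf i_neq0).
  rewrite mul0r mulrAC -ab; transitivity (a * 0 - b * 0 : C).
    by rewrite -{1}h6 -h7; ring.
  by rewrite !mulr0 subr0.
have k6E : k6 = 0.
  apply: (@lin 2) => //; apply: (mulIf i_neq0).
  rewrite mul0r mulrAC -ab; transitivity (a * 0 - b * 0 : C).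
    by rewrite -{1}h7 -h6; ring.
  by rewrite !mulr0 subr0.
case=> [[|[|[|[|[|[|[|[|//]]]]]]]] i_lt8] //=.
Qed.

Lemma coef_basisP : basis_of fullv coef_basis.
Proof. by rewrite basisEfree coef_basis_free subvf size_tuple dim_KP. Qed.

Lemma tens_funE (phi psi : KP -> C) (x y : KP) : scalar phi -> scalar psi ->
  tens_fun phi psi (tens x y) = phi x * psi y.
Proof.
have expand (f : KP -> C) z : scalar f ->
    f z = \sum_i coord can_basis i z * f can_basis`_i.
  move=> f_lin; pose f' := GRing.isLinear.Build _ _ _ _ f f_lin.
  pose F : {scalar KP} := HB.pack f f'.
  rewrite {1}(coord_basis can_basisP (memvf z)) -[f]/(F : KP -> C) linear_sum.
  by apply: eq_bigr => i _; rewrite linearZ.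
move=> phi_lin psi_lin; rewrite (expand phi x) // (expand psi y) //.
rewrite /tens_fun mulr_suml; apply: eq_bigr => i _.
rewrite mulr_sumr; apply: eq_bigr => j _; rewrite mxE; ring.
Qed.

Let Delta_coef (i : 'I_8) : Delta coef_basis`_i =
  tnth [tuple Delta_rho 0; Delta_rho 1; Delta_rho 2; Delta_rho 3;
              Delta_X 0 0; Delta_X 0 1; Delta_X 1 0; Delta_X 1 1] i.
Proof.
rewrite /Delta (bigD1 i) //= big1 ?addr0 => [|j neq_ji];
  rewrite coord_free ?coef_basis_free //; first by rewrite eqxx scale1r.
by rewrite eq_sym (negPf neq_ji) scale0r.
Qed.

Lemma Delta_linear : linear Delta.
Proof.
move=> c x y; rewrite /Delta scaler_sumr -big_split /=.
by apply: eq_bigr => i _; rewrite linearP scalerDl scalerA.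
Qed.

Lemma Delta_rhoE u : Delta (rho u) = tens (rho u) (rho u).
Proof.
have D i : Delta (tnth coef_basis i) = _ := etrans
  (congr1 Delta (tnth_nth 0 _ _)) (Delta_coef i).
case: u => [[|[|[|[|//]]]] u_lt4].
- by have := D 0; rewrite !(tnth_nth 0) /=; congr (Delta (rho _) = Delta_rho _);
    apply: val_inj.
- by have := D 1; rewrite !(tnth_nth 0) /=; congr (Delta (rho _) = Delta_rho _);
    apply: val_inj.
- by have := D 2; rewrite !(tnth_nth 0) /=; congr (Delta (rho _) = Delta_rho _);
    apply: val_inj.
- by have := D 3; rewrite !(tnth_nth 0) /=; congr (Delta (rho _) = Delta_rho _);
    apply: val_inj.
Qed.

Lemma Delta_XE i j : Delta (X i j) = \sum_k tens (X i k) (X k j).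
Proof.
have D l : Delta (tnth coef_basis l) = _ := etrans
  (congr1 Delta (tnth_nth 0 _ _)) (Delta_coef l).
case: i => [[|[|//]] i_lt2]; case: j => [[|[|//]] j_lt2].
- by have := D 4; rewrite !(tnth_nth 0) /=; congr (Delta (X _ _) = Delta_X _ _);
    apply: val_inj.
- by have := D 5; rewrite !(tnth_nth 0) /=; congr (Delta (X _ _) = Delta_X _ _);
    apply: val_inj.
- by have := D 6; rewrite !(tnth_nth 0) /=; congr (Delta (X _ _) = Delta_X _ _);
    apply: val_inj.
- by have := D 7; rewrite !(tnth_nth 0) /=; congr (Delta (X _ _) = Delta_X _ _);
    apply: val_inj.
Qed.

End KacPaljutkin.

(* Main.v *)
Require Import Defs.
From HB Require Import structures.
From mathcomp Require Import all_boot all_order all_algebra.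
From mathcomp Require Import complex.
From mathcomp Require Import all_classical all_reals all_analysis.
From mathcomp Require Import ring lra.

Import Order.TTheory GRing.Theory Num.Theory.
Local Open Scope complex_scope.
Local Open Scope ring_scope.

(* With t = g_X, the values of F(g) on the coefficient basis are diagonal (g_u
   at rho u, t/2 * delta_ij at X_ij), so convolution multiplies them entrywise
   and F(g)^*k - haar = F(h), where h has coefficients 0, g_u^k (u <> 0) and
   2 (t/2)^k. Lower bound: the projection p = (1 + rho u)/2 gives
   haar(p h) = g_u^k / 2. Upper bound: haar h = 0, hence haar(p h) =
   haar((2p - 1) h) / 2 with 2p - 1 a symmetry, and Cauchy-Schwarz followed by
   Parseval bounds this by half the L2 norm of h. *)

(** * Convolution powers on the matrix coefficients *)

Section Convolution.
Variable R : realType.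
Implicit Types (phi psi : KP R -> R[i]).

Lemma haar_scalar : scalar (@haar R).
Proof.
move=> a [[[[x1 x2] x3] x4] c] [[[[y1 y2] y3] y4] d] /=.
by rewrite mxtraceD mxtraceZ /GRing.scale /=; ring.
Qed.

Lemma fourier_scalar (x : KP R) : scalar (fourier x).
Proof.
by move=> a y z; rewrite /fourier -haar_scalar mulrDl -scalerAl.
Qed.

Lemma scalar_ext phi psi : scalar phi -> scalar psi ->
  (forall u, phi (rho R u) = psi (rho R u)) ->
  (forall i j, phi (X R i j) = psi (X R i j)) -> phi =1 psi.
Proof.
have expand f z : scalar f ->
    f z = \sum_i coord (coef_basis R) i z * f (coef_basis R)`_i.
  move=> f_lin; pose f' := GRing.isLinear.Build _ _ _ _ f f_lin.
  pose F : {scalar KP R} := HB.pack f f'.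
  rewrite {1}(coord_basis (coef_basisP R) (memvf z)) -[f]/(F : KP R -> R[i]).
  by rewrite linear_sum; apply: eq_bigr => i _; rewrite linearZ.
move=> phi_lin psi_lin eq_rho eq_X z.
rewrite (expand phi) // (expand psi) //; apply: eq_bigr => i _; congr (_ * _).
by case: i => [[|[|[|[|[|[|[|[|//]]]]]]]] ?]; (apply: eq_rho || apply: eq_X).
Qed.

Lemma tens_fun_scalar phi psi : scalar (tens_fun phi psi).
Proof.
move=> a S T; rewrite /tens_fun /= mulr_sumr -big_split; apply: eq_bigr => i _ /=.
rewrite mulr_sumr -big_split; apply: eq_bigr => j _ /=.
by rewrite !mxE mulrDl !mulrA.
Qed.

Lemma conv_scalar phi psi : scalar (Defs.conv phi psi).
Proof. by move=> a x y; rewrite /Defs.conv Delta_linear tens_fun_scalar. Qed.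

Lemma conv_rho phi psi u : scalar phi -> scalar psi ->
  Defs.conv phi psi (rho R u) = phi (rho R u) * psi (rho R u).
Proof. by move=> ? ?; rewrite /Defs.conv Delta_rhoE tens_funE. Qed.

Lemma conv_X phi psi i j : scalar phi -> scalar psi ->
  Defs.conv phi psi (X R i j) = \sum_l phi (X R i l) * psi (X R l j).
Proof.
move=> phi_lin psi_lin; rewrite /Defs.conv Delta_XE.
rewrite !big_ord_recl !big_ord0 !addr0.
by rewrite -[tens _ _]scale1r tens_fun_scalar mul1r !tens_funE.
Qed.

(** On the coefficients of one irreducible representation, convolution is matrix multiplication, by
    [conv_rho] and [conv_X]; scalar matrices therefore stay scalar along the induction, which starts
    from the first power [phi]. *)
Lemma conv_pow_diag phi (a : 'I_4 -> R[i]) (s : R[i]) k : scalar phi ->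
    (forall u, phi (rho R u) = a u) ->
    (forall i j, phi (X R i j) = s *+ (i == j)) -> (0 < k)%N ->
  [/\ scalar (conv_pow phi k), forall u, conv_pow phi k (rho R u) = a u ^+ k
    & forall i j, conv_pow phi k (X R i j) = s ^+ k *+ (i == j)].
Proof.
move=> phi_lin phi_rho phi_X; case: k => // k _; rewrite /conv_pow iteropS.
elim: k => [|k [pow_lin pow_rho pow_X]] /=; first by split.
split; first exact: conv_scalar.
  by move=> u; rewrite conv_rho // pow_rho phi_rho -exprS.
move=> i j; rewrite conv_X // (bigD1 i) //= big1 ?addr0 => [|l neq_li].
  by rewrite phi_X pow_X eqxx mulr1n mulrnAr -exprS.
by rewrite phi_X eq_sym (negPf neq_li) mul0r.
Qed.

End Convolution.

(** * Fourier transforms of combinations of characters *)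

Section CentralElements.
Variable R : realType.
Implicit Types (a : 'I_4 -> R[i]) (t : R[i]).

(** The span of the characters. Centrality refers to convolution of the Fourier transforms:
    [rho R 1] does not commute with the matrix block of the algebra. *)
Definition central a t : KP R := \sum_u a u *: rho R u + t *: chiX R.

(** The parentheses hold the coordinates of [central a t]. Its matrix block is diagonal, so the
    off-diagonal entries of [c] drop out of the trace. *)
Lemma fourier_centralE a t (x1 x2 x3 x4 : R[i]) (c : 'M[R[i]]_2) :
  fourier (central a t) (mkKP x1 x2 x3 x4 c) =
  8^-1 * (x1 * (a 0 + a 1 + a 2 + a 3 + 2 * t)
        + x2 * (a 0 - a 1 - a 2 + a 3)
        + x3 * (a 0 - a 1 - a 2 + a 3)
        + x4 * (a 0 + a 1 + a 2 + a 3 - 2 * t)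
        + 2 * (c 0 0 * (a 0 + a 1 - a 2 - a 3)
             + c 1 1 * (a 0 - a 1 + a 2 - a 3))).
Proof.
rewrite /central chiXE !big_ord_recl big_ord0 /rho !(tnth_nth 0) /=.
rewrite (_ : lift _ _ = 1 :> 'I_4); last exact: val_inj.
rewrite (_ : lift _ _ = 2 :> 'I_4); last exact: val_inj.
rewrite (_ : lift _ _ = 3 :> 'I_4); last exact: val_inj.
rewrite /fourier /e1 /e2 /e3 /e4 /E /haar /mkKP /=.
rewrite /GRing.scale /= /mxtrace !big_ord_recl !big_ord0 !mxE.
rewrite !big_ord_recl !big_ord0 !mxE /=.
rewrite (_ : lift _ _ = 1 :> 'I_2); last exact: val_inj.
rewrite (_ : @ord0 3 = 0) // (_ : @ord0 1 = 0) //; ring.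
Qed.

(** The Haar state is the Fourier transform of the unit, which is [rho R 0]. *)
Lemma haarE (x : KP R) :
  haar x = fourier (central (fun u => (u == 0)%:R) 0) x.
Proof.
case: x => [[[[x1 x2] x3] x4] c].
rewrite -[X in fourier _ X]/(mkKP x1 x2 x3 x4 c) fourier_centralE /=.
rewrite /mxtrace !big_ord_recl big_ord0 (_ : lift _ _ = 1 :> 'I_2).
  by rewrite (_ : @ord0 1 = 0) //; ring.
exact: val_inj.
Qed.

(** Orthogonality relations: the [rho R u] are self-adjoint, orthonormal for the Haar state, and
    orthogonal to [chiX R]. *)
Lemma fourier_central_rho a t u : fourier (central a t) (rho R u) = a u.
Proof.
case: u => [[|[|[|[|//]]]] lt_u4]; rewrite /rho (tnth_nth 0) /=;
  rewrite fourier_centralE !mxE /=;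
  [rewrite (_ : Ordinal _ = 0) | rewrite (_ : Ordinal _ = 1)
  | rewrite (_ : Ordinal _ = 2) | rewrite (_ : Ordinal _ = 3)];
  by [field | exact: val_inj].
Qed.

(** The factor 1/2 is the inverse of the dimension of the representation: each [X R i i] has squared
    Haar norm 1/2. *)
Lemma fourier_central_X a t i j :
  fourier (central a t) (X R i j) = (t / 2) *+ (i == j).
Proof.
case: i j => [[|[|//]] ?] [[|[|//]] ?];
  rewrite /X /= fourier_centralE !mxE /=.
- by field.
- by rewrite !(scaler0, mulr0, addr0, mul0r).
- by rewrite !(scaler0, mulr0, addr0, mul0r).
- by field.
Qed.

(** A coefficient [s] of [chiX R] shows up as [s / 2] on the diagonal, hence the outer factor 2
    around [(t / 2) ^+ k]. *)
Lemma conv_pow_fourier_central a t k : (0 < k)%N ->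
  conv_pow (fourier (central a t)) k =1
  fourier (central (fun u => a u ^+ k) (2 * (t / 2) ^+ k)).
Proof.
move=> k_gt0.
have [pow_lin pow_rho pow_X] := conv_pow_diag _ _ a (t / 2) k
  (fourier_scalar _ _) (fourier_central_rho a t) (fourier_central_X a t) k_gt0.
apply: scalar_ext => //; first exact: fourier_scalar.
- by move=> u; rewrite pow_rho; exact/esym/fourier_central_rho.
- move=> i j; rewrite pow_X; apply/esym.
  by rewrite fourier_central_X mulrAC divff ?pnatr_eq0 // mul1r.
Qed.

Lemma fourier_central_subhaar a t x : a 0 = 1 ->
  fourier (central a t) x - haar x =
  fourier (central (fun u => if u == 0 then 0 else a u) t) x.
Proof.
move=> a0; rewrite haarE; case: x => [[[[x1 x2] x3] x4] c].
have E b s := fourier_centralE b s x1 x2 x3 x4 c.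
apply: etrans (congr2 (fun y z => y - z) (E _ _) (E _ _)) _.
by apply: etrans _ (esym (E _ _)); rewrite a0 /=; ring.
Qed.

End CentralElements.

(** * The upper bound on projections *)

Section Bounds.
Variable R : realType.

Lemma sqr_normcE (z : R[i]) :
  Normc.normc z ^+ 2 = complex.Re z ^+ 2 + complex.Im z ^+ 2.
Proof. by case: z => x y; rewrite sqr_sqrtr // addr_ge0 ?sqr_ge0. Qed.

Lemma normc_nat m : Normc.normc (m%:R : R[i]) = m%:R.
Proof. by rewrite -[m%:R]mulr_natl mulr1 normcMn Normc.normc1. Qed.

(* The relations satisfied by a diagonal entry z and an off-diagonal entry w of
   a projection in M_2(C), or by a scalar projection z when w = 0. *)
Lemma normc_sign_le1 (z w : R[i]) : z^*%C = z -> z = z * z + w * w^*%C ->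
  Normc.normc (2 * z - 1) <= 1.
Proof.
case: z w => [x y] [a b] [y0]; have {y0} -> : y = 0 by lra.
(* For real z = x, the relation gives (2x - 1)^2 = 1 - 4|w|^2. *)
move=> [x_eq _]; rewrite /= -[leRHS]sqrtr1; apply: ler_wsqrtr.
nra.
Qed.

(* Cauchy-Schwarz for the Haar weights 1, 2, 1, 2, 2 of an element whose second
   and third components agree. *)
Lemma weighted_mean_sqr_le (y1 y2 y4 y5 y6 : R) :
  (16^-1 * (y1 + y2 + y2 + y4 + 2 * (y5 + y6))) ^+ 2 <=
  4^-1 * (8^-1 * (y1 ^+ 2 + 2 * y2 ^+ 2 + y4 ^+ 2 + 2 * (y5 ^+ 2 + y6 ^+ 2))).
Proof.
(* Lagrange's identity: the gap is a sum over pairs of squared differences, each weighted by the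
   product of the two weights. *)
rewrite -subr_ge0 (_ : _ - _ = 256^-1 * (2 * (y1 - y2) ^+ 2 + (y1 - y4) ^+ 2
  + 2 * (y1 - y5) ^+ 2 + 2 * (y1 - y6) ^+ 2 + 2 * (y2 - y4) ^+ 2
  + 4 * (y2 - y5) ^+ 2 + 4 * (y2 - y6) ^+ 2 + 2 * (y4 - y5) ^+ 2
  + 2 * (y4 - y6) ^+ 2 + 4 * (y5 - y6) ^+ 2)); last by field.
by rewrite !(sqr_ge0, invr_ge0, ler0n, addr_ge0, mulr_ge0).
Qed.

Lemma fourier_central_projection_le (a : 'I_4 -> R[i]) t p :
  a 0 = 0 -> is_projection p ->
  Normc.normc (fourier (central R a t) p) <=
  Num.sqrt (4^-1 * (\sum_(v | v != 0) Normc.normc (a v) ^+ 2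
                    + Normc.normc t ^+ 2)).
Proof.
move=> a0; case: p => [[[[x1 x2] x3] x4] c] [].
rewrite /star /mkKP => -[] x1J x2J x3J x4J /matrixP cJ.
move=> -[] x1I x2I x3I x4I /matrixP cI.
have x_sign (x : R[i]) : x^*%C = x -> x * x = x -> Normc.normc (2 * x - 1) <= 1.
  by move=> xJ xI; apply: (normc_sign_le1 _ 0) => //; rewrite mul0r addr0.
have s1 := x_sign _ x1J x1I; have s2 := x_sign _ x2J x2I.
have s3 := x_sign _ x3J x3I; have s4 := x_sign _ x4J x4I.
(* Self-adjointness makes the off-diagonal entries conjugate, so a diagonal entry of [c *m c = c]
   becomes the relation of [normc_sign_le1]. *)
have E01 := cJ 0 1; have E10 := cJ 1 0; rewrite !mxE in E01 E10.
have s5 : Normc.normc (2 * c 0 0 - 1) <= 1.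
  apply: (normc_sign_le1 _ (c 0 1)); first by rewrite -[RHS]cJ !mxE.
  by rewrite E10 -[LHS]cI mxE !big_ord_recl big_ord0 addr0;
    congr (c _ _ * c _ _ + c _ _ * c _ _); exact: val_inj.
have s6 : Normc.normc (2 * c 1 1 - 1) <= 1.
  apply: (normc_sign_le1 _ (c 1 0)); first by rewrite -[RHS]cJ !mxE.
  by rewrite E01 -[LHS]cI mxE !big_ord_recl big_ord0 addr0 addrC;
    congr (c _ _ * c _ _ + c _ _ * c _ _); exact: val_inj.
rewrite fourier_centralE !big_mkcond !big_ord_recl big_ord0 /=.
rewrite (_ : lift _ _ = 1 :> 'I_4); last exact: val_inj.
rewrite (_ : lift _ _ = 2 :> 'I_4); last exact: val_inj.
rewrite (_ : lift _ _ = 3 :> 'I_4); last exact: val_inj.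
rewrite a0 !add0r addr0 {a0 x_sign cI cJ E01 E10 x1J x2J x3J x4J x1I x2I x3I x4I}.
move: (a 1) (a 2) (a 3) (c 0 0) (c 1 1) s1 s2 s3 s4 s5 s6.
move=> {a c} a1 a2 a3 c0 c1 s1 s2 s3 s4 s5 s6.
(* The coordinates of the density; its second and third ones are both [h2]. *)
pose h1 := a1 + a2 + a3 + 2 * t; pose h2 := - a1 - a2 + a3.
pose h4 := a1 + a2 + a3 - 2 * t.
pose h5 := a1 - a2 - a3; pose h6 := - a1 + a2 - a3.
(* Subtracting 1/2 from each diagonal coordinate of the projection changes nothing: h1 + 2 h2 + h4 +
   2 (h5 + h6) = 0, because the coefficient at the unit vanishes. *)
rewrite (_ : 8^-1 * _ = 16^-1 * ((2 * x1 - 1) * h1 + (2 * x2 - 1) * h2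
  + (2 * x3 - 1) * h2 + (2 * x4 - 1) * h4
  + 2 * ((2 * c0 - 1) * h5 + (2 * c1 - 1) * h6))); last first.
  by rewrite /h1 /h2 /h4 /h5 /h6; field.
have normc_ge0 z : 0 <= @Normc.normc R z by case: z => *; exact: sqrtr_ge0.
have contract (s h : R[i]) : Normc.normc s <= 1 ->
    Normc.normc (s * h) <= Normc.normc h.
  by move=> s_le1; rewrite Normc.normcM ler_piMl.
pose n z := @Normc.normc R z.
rewrite Normc.normcM Normc.normcV normc_nat.
have le_sum : Normc.normc ((2 * x1 - 1) * h1 + (2 * x2 - 1) * h2
  + (2 * x3 - 1) * h2 + (2 * x4 - 1) * h4
  + 2 * ((2 * c0 - 1) * h5 + (2 * c1 - 1) * h6)) <=
  n h1 + n h2 + n h2 + n h4 + 2 * (n h5 + n h6).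
  do ![apply: le_trans (le_normcD _ _) _; apply: lerD]; try exact: contract.
  rewrite Normc.normcM normc_nat ler_pM2l ?ltr0n //.
  by apply: le_trans (le_normcD _ _) _; apply: lerD; exact: contract.
(* The characters are orthonormal for the Haar state; the factor 8 is the total Haar weight. *)
have parseval : n h1 ^+ 2 + 2 * n h2 ^+ 2 + n h4 ^+ 2 + 2 * (n h5 ^+ 2 + n h6 ^+ 2) =
    8 * (n a1 ^+ 2 + n a2 ^+ 2 + n a3 ^+ 2 + n t ^+ 2).
  rewrite /n !sqr_normcE /h1 /h2 /h4 /h5 /h6.
  clear; case: a1 a2 a3 t => [? ?] [? ?] [? ?] [? ?] /=; ring.
apply: le_trans (_ : 16^-1 * (n h1 + n h2 + n h2 + n h4 + 2 * (n h5 + n h6)) <= _).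
  by rewrite ler_pM2l ?invr_gt0 ?ltr0n.
rewrite -[leLHS]ger0_norm -?sqrtr_sqr; last first.
  by rewrite !(mulr_ge0, addr_ge0, invr_ge0, ler0n, normc_ge0).
apply: ler_wsqrtr; rewrite !addrA -!/(n _).
move: (n h1) (n h2) (n h4) (n h5) (n h6) parseval; clear.
move=> y1 y2 y4 y5 y6 parseval.
have -> : n a1 ^+ 2 + n a2 ^+ 2 + n a3 ^+ 2 + n t ^+ 2 =
  8^-1 * (y1 ^+ 2 + 2 * y2 ^+ 2 + y4 ^+ 2 + 2 * (y5 ^+ 2 + y6 ^+ 2)).
  by rewrite parseval; field.
exact: weighted_mean_sqr_le.
Qed.

End Bounds.

(** * Projections built from the one-dimensional representations *)

Section Projections.
Variable R : realType.

Lemma starD (x y : KP R) : star (x + y) = star x + star y.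
Proof.
case: x y => [[[[x1 x2] x3] x4] c] [[[[y1 y2] y3] y4] d].
by rewrite /star /mkKP /= !rmorphD linearD map_mxD.
Qed.

Lemma starZ a (x : KP R) : star (a *: x) = a^*%C *: star x.
Proof.
case: x => [[[[x1 x2] x3] x4] c].
by rewrite /star /mkKP /= /GRing.scale /= !rmorphM linearZ map_mxZ.
Qed.

Lemma starN (x : KP R) : star (- x) = - star x.
Proof. by rewrite -scaleN1r starZ rmorphN1 scaleN1r. Qed.

Lemma star_rho u : star (rho R u) = rho R u.
Proof.
have starE i : star (E R i i) = E R i i.
  by rewrite /star /E /mkKP !conjc0 trmx_delta map_delta_mx.
have star1 : star (e1 R) = e1 R.
  by rewrite /star /e1 /mkKP !conjc0 conjc1 trmx0 map_mx0.
have star2 : star (e2 R) = e2 R.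
  by rewrite /star /e2 /mkKP !conjc0 conjc1 trmx0 map_mx0.
have star3 : star (e3 R) = e3 R.
  by rewrite /star /e3 /mkKP !conjc0 conjc1 trmx0 map_mx0.
have star4 : star (e4 R) = e4 R.
  by rewrite /star /e4 /mkKP !conjc0 conjc1 trmx0 map_mx0.
rewrite /rho (tnth_nth 0); case: u => [[|[|[|[|//]]]] ?];
  by rewrite [nth _ _ _]/= !(starD, starN) !starE star1 star2 star3 star4.
Qed.

Lemma rho_sqr u : rho R u * rho R u = 1.
Proof.
rewrite -rho0E /rho !(tnth_nth 0) /=.
case: u => [[|[|[|[|//]]]] lt_u4] /=; rewrite /e1 /e2 /e3 /e4 /E /mkKP /=;
  congr (_, _, _, _, _) => /=; try by ring.
all: apply/matrixP => i j; rewrite !mxE !big_ord_recl big_ord0 !mxE.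
all: by case: i j => [[|[|//]] ?] [[|[|//]] ?] /=; ring.
Qed.

(** This is the spectral projection of the symmetry [s] for the eigenvalue 1. *)
Lemma halved_projection (s : KP R) : star s = s -> s * s = 1 ->
  is_projection (2^-1 *: (1 + s)).
Proof.
move=> sJ s2; split.
  rewrite starZ starD sJ -rho0E star_rho; congr (_ *: _).
  by rewrite fmorphV rmorph_nat.
have sq : (1 + s) * (1 + s) = 2 *: (1 + s).
  by rewrite mulrDl !mulrDr s2 !mulr1 mul1r [s + 1]addrC scaler_nat mulr2n.
have half_sq : 2^-1 *: ((1 + s) * (1 + s)) = 1 + s.
  by rewrite sq scalerA mulVf ?pnatr_eq0 // scale1r.
by rewrite -scalerAl -scalerAr; congr (_ *: _); exact: half_sq.
Qed.

End Projections.

(** * Both bounds on the distance to the Haar state *)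

Theorem lemma2p1 (R : realType) (g : 'I_4 -> R[i]) (gX : R[i])
    (G : KP R) (defG : G = \sum_u g u *: rho R u + gX *: chiX R)
    (G_state : is_state (fourier G)) (u : 'I_4) (k : nat) :
  u != 0 -> (0 < k)%N ->
  2^-1 * Normc.normc (g u) ^+ k <= QTV (conv_pow (fourier G) k) (@haar R)
    <= Num.sqrt (4^-1 * (\sum_(v | v != 0) Normc.normc (g v) ^+ (2 * k))
                 + Normc.normc gX ^+ (2 * k) / 4 ^+ k).
Proof.
move=> u_neq0 k_gt0.
(* Unitality of the state, read at [rho R 0]. *)
have g0 : g 0 = 1.
  case: G_state => _ _; rewrite -rho0E defG => <-.
  exact/esym/fourier_central_rho.
have normcX (z : R[i]) m : Normc.normc (z ^+ m) = Normc.normc z ^+ m.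
  by elim: m => [|m IHm]; rewrite ?Normc.normc1 // !exprS Normc.normcM IHm.
pose b v : R[i] := if v == 0 then 0 else g v ^+ k.
pose t := 2 * (gX / 2) ^+ k.
have diffE p : conv_pow (fourier G) k p - haar p = fourier (central R b t) p.
  rewrite defG conv_pow_fourier_central //; apply: fourier_central_subhaar.
  by rewrite g0 expr1n.
have le_bound p : is_projection p ->
    Normc.normc (conv_pow (fourier G) k p - haar p) <=
    Num.sqrt (4^-1 * (\sum_(v | v != 0) Normc.normc (g v) ^+ (2 * k))
              + Normc.normc gX ^+ (2 * k) / 4 ^+ k).
  move=> p_proj; rewrite diffE.
  apply: le_trans (fourier_central_projection_le _ _ _ _ _ p_proj) _ => //.
  rewrite le_eqVlt; apply/orP; left; apply/eqP; congr Num.sqrt.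
  rewrite mulrDr; congr (_ * _ + _).
    apply: eq_bigr => v v_neq0; rewrite /b (negPf v_neq0) normcX.
    by rewrite mulnC exprM.
  (* The 1/4 outside cancels the square of the factor 2 in [t], which leaves |gX / 2|^(2k). *)
  rewrite Normc.normcM normcX Normc.normcM Normc.normcV !normc_nat.
  rewrite exprMn -exprM [(k * 2)%N]mulnC exprMn exprVn [in X in _ / X ^+ k](_ : 4 = 2 ^+ 2 :> R).
    by rewrite -exprM; field; rewrite expf_neq0 ?pnatr_eq0.
  by rewrite -natrX.
have half_proj : is_projection (2^-1 *: (1 + rho R u)).
  exact: halved_projection (star_rho _ u) (rho_sqr _ u).
apply/andP; split.
  apply: le_trans (_ : _ <= Normc.normc (conv_pow (fourier G) k
    (2^-1 *: (1 + rho R u)) - haar (2^-1 *: (1 + rho R u)))) _.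
    rewrite diffE.
    (* By linearity the value at the projection is (b 0 + b u) / 2, with b 0 = 0. *)
    pose F := GRing.isLinear.Build _ _ _ _ _ (fourier_scalar _ (central R b t)).
    pose f : {scalar KP R} := HB.pack (fourier (central R b t)) F.
    rewrite -[fourier _]/(f : KP R -> R[i]) linearZ linearD.
    rewrite -rho0E /f /= !fourier_central_rho /b eqxx (negPf u_neq0) add0r.
    by rewrite Normc.normcM Normc.normcV normc_nat normcX.
  apply: ub_le_sup; last by exists (2^-1 *: (1 + rho R u)).
  (* A value is below [sup] only if the set is bounded; the upper bound supplies this. *)
  by eexists => _ [p p_proj <-]; exact: le_bound.
apply: ge_sup => [|_ [p p_proj <-]]; last exact: le_bound.
by eexists; exists (2^-1 *: (1 + rho R u)); [exact: half_proj|].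
Qed.
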